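(* Let $\alpha$ be a positive real algebraic number. The monoid $M_\alpha$ is antimatter if and only if the simplified polynomial of $r_\alpha(x)$ has a Perron number as a root and $\alpha$ has no positive conjugate aside from itself.
   Context: $\mathbb{N} = \{1,2,\dots\}$, $\mathbb{N}_0 = \mathbb{N}\cup\{0\}$. For $\alpha \in \mathbb{C}$, $M_\alpha := \{p(\alpha) : p(x) \in \mathbb{N}_0[x]\}$, viewed as a (cancellative commutative) monoid under addition, where $\mathbb{N}_0[x]$ is the set of polynomials with nonnegative integer coefficients. An atom of an additively written monoid $M$ is a non-invertible element $a \in M$ such that $a = b+c$ with $b,c \in M$ implies that $b$ or $c$ is invertible in $M$. A monoid is antimatter if it has no atoms. For algebraic $\alpha$ with minimal polynomial $m_\alpha(x)\in\mathbb{Q}[x]$ of degree $d$, $r_\alpha(x) := x^d m_\alpha(1/x)$ is its reciprocal polynomial. A nonconstant polynomial $f(x) \in \mathbb{Q}[x]$ is simple if the only pair $(n,g(x)) \in \mathbb{N} \times \mathbb{Q}[x]$ with $f(x) = g(x^n)$ is $(1,f(x))$. The simplified polynomial of $f(x) \in \mathbb{Q}[x]$ is the unique simple polynomial $g(x) \in \mathbb{Q}[x]$ such that $f(x) = g(x^n)$ for some $n \in \mathbb{N}$. A Perron number is a real algebraic integer greater than $1$ that strictly exceeds each of its other algebraic conjugates (over $\mathbb{Q}$) in absolute value. *)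

(* Defs.v *)
From HB Require Import structures.
From mathcomp Require Import all_boot all_order all_algebra all_field.

Set Implicit Arguments.
Unset Strict Implicit.
Unset Printing Implicit Defensive.

Import Order.TTheory GRing.Theory Num.Theory.
Local Open Scope ring_scope.

(* Submonoids of an ambient additive commutative monoid V are given by their
   membership predicates; invertibility and atoms are relative to the submonoid
   M, not to V. *)
Section Atoms.

Variables (V : nmodType) (M : V -> Prop).

Definition invertible_in (u : V) : Prop := M u /\ exists2 v, M v & u + v = 0.

Definition atom_of (a : V) : Prop :=
  [/\ M a, ~ invertible_in a
    & forall b c, M b -> M c -> a = b + c -> invertible_in b \/ invertible_in c].

Definition antimatter : Prop := forall a, ~ atom_of a.

End Atoms.

Definition nat_eval_monoid (alpha : algC) : algC -> Prop :=
  fun x => exists p : {poly nat}, x = (map_poly (fun n => n%:R) p).[alpha].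

Lemma nat_eval_monoid0 (alpha : algC) : nat_eval_monoid alpha 0.
Proof. by exists 0; rewrite rmorph0 horner0. Qed.

Lemma nat_eval_monoidD (alpha x y : algC) :
  nat_eval_monoid alpha x -> nat_eval_monoid alpha y ->
  nat_eval_monoid alpha (x + y).
Proof. by move=> [p ->] [q ->]; exists (p + q); rewrite rmorphD hornerD. Qed.

(* minCpoly has coefficients in algC; this is the same polynomial in Q[x]. *)
Definition minQpoly (alpha : algC) : {poly rat} := sval (minCpolyP alpha).

Lemma minQpolyP (alpha : algC) :
  [/\ minCpoly alpha = map_poly ratr (minQpoly alpha), minQpoly alpha \is monic
    & forall q : {poly rat},
        root (map_poly ratr q) alpha = (minQpoly alpha %| q)].
Proof. by rewrite /minQpoly; case: (minCpolyP alpha) => p []. Qed.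

(* x ^ d * p(1 / x), with d = (size p).-1 the degree of p. *)
Definition reciprocal_poly (R : nzRingType) (p : {poly R}) : {poly R} :=
  \sum_(i < size p) p`_i *: 'X^((size p).-1 - i).

Lemma size_reciprocal_minQpoly (alpha : algC) :
  alpha != 0 -> (1 < size (reciprocal_poly (minQpoly alpha)))%N.
Proof.
case: (minQpolyP alpha); set p := minQpoly alpha => pE p_monic p_min a0.
have p1 : (1 < size p)%N by rewrite -(size_map_poly (@ratr algC)) -pE size_minCpoly.
have p0 : p`_0 != 0.
  apply: contra a0 => p0; have /factor_theorem[q pq] : root p 0 by rewrite /root horner_coef0.
  have q0 : q != 0 by apply: contraTneq p1 => q0; rewrite pq q0 mul0r size_poly0.
  have := root_minCpoly alpha; rewrite pE pq rmorphM rootM p_min.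
  case/orP=> [/(dvdp_leq q0)|].
    by rewrite pq size_Mmonic ?monicXsubC // size_XsubC addn2 ltnn.
  by rewrite rmorphB /= map_polyX map_polyC /= rmorph0 root_XsubC.
rewrite (@leq_trans (size p)) //; have /prednK <- := ltnW p1.
rewrite ltnNge; apply: contra p0 => /leq_sizeP/(_ _ (leqnn _)).
have -> : reciprocal_poly p = \sum_(i < (size p).-1.+1) p`_i *: 'X^((size p).-1 - i).
  by rewrite prednK // ltnW.
rewrite coef_sum big_ord_recl subn0 coefZ coefXn eqxx mulr1 big1 ?addr0 => [/eqP //|i _].
rewrite coefZ coefXn /= /bump add1n.
by rewrite gtn_eqF ?mulr0 // ltn_subrL /= (leq_ltn_trans _ (ltn_ord i)).
Qed.

Definition simple_poly (f : {poly rat}) : Prop :=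
  (1 < size f)%N /\
  forall (n : nat) (g : {poly rat}),
    (0 < n)%N -> f = g \Po 'X^n -> n = 1%N /\ g = f.

Definition simplification (f g : {poly rat}) : Prop :=
  simple_poly g /\ exists2 n : nat, (0 < n)%N & f = g \Po 'X^n.

Lemma decimate_polyK (f : {poly rat}) n :
  (0 < n)%N -> (forall i, ~~ (n %| i)%N -> f`_i = 0) ->
  f = (\poly_(i < size f) f`_(i * n)) \Po 'X^n.
Proof.
move=> n0 fn; apply/polyP=> i; rewrite coef_comp_poly_Xn //.
case: ifPn => [ni|/fn //]; rewrite coef_poly divnK //.
case: ltnP => // le_f; rewrite nth_default //.
exact: leq_trans le_f (leq_div _ _).
Qed.

Lemma simplification_exists (f : {poly rat}) :
  (1 < size f)%N -> {g | simplification f g}.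
Proof.
move=> f1.
pose P n := (0 < n)%N && [forall i : 'I_(size f), ~~ (n %| i)%N ==> (f`_i == 0)].
have PE n : P n -> (0 < n)%N /\ forall i, ~~ (n %| i)%N -> f`_i = 0.
  case/andP=> n0 /forallP Pn; split=> // i ni.
  have [lt_i|le_i] := ltnP i (size f); last by rewrite nth_default.
  by have /implyP/(_ ni)/eqP := Pn (Ordinal lt_i).
have exP : exists n, P n.
  by exists 1%N; apply/forallP=> i; rewrite dvd1n.
have leP n : P n -> (n <= size f)%N.
  case/PE=> n0 fn; apply: leq_trans (leq_pred _).
  apply: dvdn_leq; first by rewrite -subn1 subn_gt0.
  apply: contraT => /fn /eqP; rewrite -/(lead_coef f) lead_coef_eq0 => /eqP f0.
  by rewrite f0 size_poly0 in f1.
case: (ex_maxnP exP leP) => n /PE [n0 fn] max_n.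
have fE := decimate_polyK n0 fn.
set g := \poly_(i < _) _ in fE.
exists g; split; last by exists n.
split.
  rewrite ltnNge; apply/negP=> /size1_polyC g_const.
  by move: f1; rewrite fE g_const comp_polyC ltnNge size_polyC_leq1.
move=> m h m0 gE.
have fhE : f = h \Po 'X^(m * n) by rewrite fE gE -comp_polyA comp_Xn_poly -exprM mulnC.
have /max_n : P (m * n)%N.
  rewrite /P muln_gt0 m0 n0; apply/forallP=> i; apply/implyP=> /negPf ni.
  by rewrite (congr1 (fun q : {poly rat} => q`_i) fhE) coef_comp_poly_Xn ?muln_gt0 ?m0 ?n0 // ni.
rewrite -[leqRHS]mul1n leq_pmul2r // => m1.
have {m0 m1} m1 : m = 1%N by apply/eqP; rewrite eqn_leq m1 m0.
by split=> //; rewrite gE m1 comp_polyXr.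
Qed.

Lemma simplification_unique (f g h : {poly rat}) :
  simplification f g -> simplification f h -> g = h.
Proof.
have coef0 (p q : {poly rat}) n i :
    (0 < n)%N -> p = q \Po 'X^n -> ~~ (n %| i)%N -> p`_i = 0.
  by move=> n0 -> /negPf ni; rewrite coef_comp_poly_Xn // ni.
have inj n : (0 < n)%N -> injective (fun p : {poly rat} => p \Po 'X^n).
  move=> n0 p q /polyP pq; apply/polyP=> i.
  by have := pq (i * n)%N; rewrite !coef_comp_poly_Xn // dvdn_mull // mulnK.
move=> [[_ sg] [n n0 fg]] [[_ sh] [m m0 fh]].
pose L := lcmn n m; have L0 : (0 < L)%N by rewrite lcmn_gt0 n0.
have fL i : ~~ (L %| i)%N -> f`_i = 0.
  by rewrite dvdn_lcm negb_and => /orP[]; [apply: coef0 fg|apply: coef0 fh].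
have := decimate_polyK L0 fL; set k := \poly_(i < _) _ => fk.
have aux q l : (0 < l)%N -> (l %| L)%N -> f = q \Po 'X^l ->
    (forall r p, (0 < r)%N -> q = p \Po 'X^r -> r = 1%N /\ p = q) -> k = q.
  move=> l0 lL fq sq.
  have r0 : (0 < L %/ l)%N by rewrite divn_gt0 // dvdn_leq.
  suff qk : q = k \Po 'X^(L %/ l) by case: (sq _ _ r0 qk).
  by apply: (inj l l0) => /=; rewrite -fq -comp_polyA comp_Xn_poly -exprM mulnC divnK.
by rewrite -(aux g n) ?dvdn_lcml // -(aux h m) ?dvdn_lcmr.
Qed.

Lemma simplified_poly_subproof (f : {poly rat}) :
  {g | (1 < size f)%N -> simplification f g}.
Proof.
have [/simplification_exists[g fg]|_] := ltnP 1 (size f); first by exists g.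
by exists f.
Qed.

(* Meaningful only for nonconstant f; constants have no simplification. *)
Definition simplified_poly (f : {poly rat}) : {poly rat} :=
  sval (simplified_poly_subproof f).

Lemma simplified_polyP (f : {poly rat}) :
  (1 < size f)%N -> simplification f (simplified_poly f).
Proof. exact: svalP (simplified_poly_subproof f). Qed.

Definition conjugate (alpha beta : algC) : Prop := root (minCpoly alpha) beta.

Definition perron_number (x : algC) : Prop :=
  [/\ x \in Aint, 1 < x
    & forall y, conjugate x y -> y != x -> `|y| < x].

(* Main.v *)
Require Import Defs.
From mathcomp Require Import all_boot all_order all_algebra all_field.
From mathcomp Require Import ring.
From Stdlib Require Import Classical.

Set Implicit Arguments.
Unset Strict Implicit.
Unset Printing Implicit Defensive.

Import Order.TTheory GRing.Theory Num.Theory.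
Local Open Scope ring_scope.

(* Put b = 1 / alpha. The monoid is antimatter iff 1 = sum_(i > 0) w_i alpha ^ i for
   some natural numbers w_i, with alpha < 1; write r(x) = g(x ^ k) with g simple.

   Given such w, a conjugate c of alpha satisfies sum_i w_i c ^ i = 1, so monotonicity
   leaves no other positive conjugate, and the triangle inequality gives
   |c| >= alpha, with equality only if c ^ i = alpha ^ i for some i > 0. So a root y
   of g with |y| = b ^ k satisfies y ^ i = (b ^ k) ^ i, and simplicity of g forces
   y = b ^ k, which is therefore a Perron number.

   Conversely let x be the Perron root of g; it is b ^ k and has no other positive
   conjugate. Some polynomial Q with nonnegative coefficients and positive low
   coefficients vanishes at the other conjugates of x. Modulo the minimal polynomial
   of x, 'X ^ N is x ^ N Q / Q(x) up to coefficients of order o(x ^ N). Rounding down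
   the coefficients of degree >= deg x and correcting the low ones, which stay
   positive, makes x ^ N a natural combination of bounded powers of x. *)

(** * Size estimates: interpolation and geometric growth *)

(** Interpolation at distinct nodes, by induction: in p = p1 (X - a) + p(a), the value of p1 at
    another node z is (p(z) - p(a)) / (z - a). *)
Lemma coef_bound_of_values (R : numFieldType) (rs : seq R) :
  uniq rs ->
  exists2 C, 0 <= C & forall p : {poly R}, (size p <= size rs)%N ->
    forall j, `|p`_j| <= C * \sum_(z <- rs) `|p.[z]|.
Proof.
elim: rs => [_|a rs IH /= /andP[a_rs /IH[C C0 IHC]]].
  exists 0 => // p; rewrite leqn0 size_poly_eq0 => /eqP-> j.
  by rewrite coef0 normr0 mul0r.
pose E := \sum_(z <- rs) 2 / `|z - a|.
have E0 : 0 <= E by apply: sumr_ge0 => z _; rewrite divr_ge0.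
exists (C * E * (1 + `|a|) + 1) => [|p sp j]; first by rewrite addr_ge0 ?mulr_ge0 ?addr_ge0.
set S := \sum_(z <- _) _.
have S0 : 0 <= S by apply: sumr_ge0.
have Sz z : z \in a :: rs -> `|p.[z]| <= S.
  by move=> zs; rewrite /S (big_rem z) //= lerDl sumr_ge0.
have /factor_theorem[p1 pE] : root (p - p.[a]%:P) a.
  by rewrite /root hornerD hornerN hornerC subrr.
have {}pE : p = p1 * ('X - a%:P) + p.[a]%:P by rewrite -pE subrK.
have sp1 : (size p1 <= size rs)%N.
  have [->|p10] := eqVneq p1 0; first by rewrite size_poly0.
  have : (size (p - p.[a]%:P)%R <= (size rs).+1)%N.
    rewrite (leq_trans (size_polyD _ _)) // geq_max sp size_polyN.
    by rewrite (leq_trans (size_polyC_leq1 _)).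
  by rewrite {1}pE addrK size_Mmonic ?monicXsubC // size_XsubC addn2.
have vals : \sum_(z <- rs) `|p1.[z]| <= S * E.
  rewrite /E mulr_sumr !big_seq ler_sum // => z zrs.
  have za : z - a != 0 by rewrite subr_eq0; apply: contraNneq a_rs => <-.
  have -> : p1.[z] = (p.[z] - p.[a]) / (z - a).
    by rewrite {1}pE !hornerE addrK mulfK.
  rewrite normrM normfV mulrA ler_pM2r ?invr_gt0 ?normr_gt0 // mulr_natr mulr2n.
  by rewrite (le_trans (ler_normB _ _)) // lerD // Sz // inE ?zrs ?orbT ?eqxx.
have coefb i : `|p1`_i| <= C * E * S.
  by rewrite (le_trans (IHC _ sp1 i)) // -mulrA (mulrC E) ler_wpM2l.
rewrite {1}pE coefD mulrBr coefB coefMX coefMC coefC mulrDl mul1r mulrDr mulr1 mulrDl.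
rewrite (le_trans (ler_normD _ _)) // lerD //.
  rewrite (le_trans (ler_normB _ _)) // lerD //.
    by case: ifP => _; rewrite ?normr0 ?mulr_ge0.
  by rewrite normrM mulrAC ler_wpM2r.
by case: ifP => _; rewrite ?normr0 // Sz ?mem_head.
Qed.

(** The elementary bound N (g - r) r^N <= g^(N+1), proved by induction, suffices once N is large
    enough by the Archimedean property. *)
Lemma geometric_dominates (R : archiNumFieldType) (r g delta : R) :
  0 <= r < g -> 0 < delta ->
  exists N0, forall N, (N0 <= N)%N -> r ^+ N <= delta * g ^+ N.
Proof.
case/andP=> r0 rg d0; have g0 : 0 < g by apply: le_lt_trans rg.
have s0 : 0 < g - r by rewrite subr_gt0.
have key N : N%:R * (g - r) * r ^+ N <= g * g ^+ N.
  elim: N => [|N IH]; first by rewrite !mul0r mulr_ge0 ?exprn_ge0 ?ltW.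
  rewrite -natr1 mulrDl mul1r mulrDl.
  have -> : g * g ^+ N.+1 = r * (g * g ^+ N) + (g - r) * g ^+ N.+1.
    by rewrite exprS mulrBl; ring.
  apply: lerD; last first.
    by apply: (ler_wpM2l (ltW s0)); apply: lerXn2r; rewrite ?nnegrE // ltW.
  by rewrite exprS mulrCA ler_wpM2l.
have c0 : 0 <= g / ((g - r) * delta) by rewrite divr_ge0 ?mulr_ge0 ?ltW.
exists (Num.bound (g / ((g - r) * delta))) => N leN.
have lN : g < N%:R * ((g - r) * delta).
  rewrite -ltr_pdivrMr ?mulr_gt0 //; apply: lt_le_trans (archi_boundP c0) _.
  by rewrite ler_nat.
have N0 : 0 < (N%:R : R).
  by rewrite -(pmulr_lgt0 _ (mulr_gt0 s0 d0)) (lt_trans g0).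
rewrite -(ler_pM2l (mulr_gt0 N0 s0)) (le_trans (key N)) // mulrA ler_wpM2r ?exprn_ge0 ?ltW //.
by rewrite -mulrA.
Qed.

(** To be applied with [g] a Perron number, [rs] its other conjugates and [C] a bound on rounding
    errors. *)
Lemma sum_geometric_dominates (R : archiNumFieldType) (rs : seq R) (g C delta : R) :
  1 < g -> (forall z, z \in rs -> `|z| < g) -> 0 <= C -> 0 < delta ->
  exists N0, forall N, (N0 <= N)%N ->
    \sum_(z <- rs) `|z| ^+ N + C <= delta * g ^+ N.
Proof.
move=> g1; elim: rs delta => [|a rs IH] delta rsg C0 d0.
  have C1 : 0 < C + 1 by rewrite ltr_wpDl.
  have [|N0 HN0] := @geometric_dominates R 1 g (delta / (C + 1)) _ (divr_gt0 d0 C1).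
    by rewrite ler01.
  exists N0 => N /HN0; rewrite expr1n big_nil add0r mulrAC ler_pdivlMr // mul1r.
  by apply: le_trans; rewrite lerDl ler01.
have d2 : 0 < delta / 2 by rewrite divr_gt0.
have ag : 0 <= `|a| < g by rewrite normr_ge0 rsg ?mem_head.
have [N1 HN1] := geometric_dominates ag d2.
have [|N2 HN2] := IH (delta / 2) _ C0 d2; first by move=> z zr; rewrite rsg // inE zr orbT.
exists (maxn N1 N2) => N; rewrite geq_max => /andP[/HN1 h1 /HN2 h2].
by rewrite big_cons -addrA (le_trans (lerD h1 h2)) // -mulrDl -splitr.
Qed.

(** * Polynomials with nonnegative coefficients and prescribed roots *)

(** Repeated squaring: d = |w| - Re w becomes 2 d (|w| + Re w) when w is squared. While Re w > 0,
    the ratio d / |w| thus at least doubles; once it exceeds 1, Re w is negative. *)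
Lemma exists_power_Re_le0 (C : archiClosedFieldType) (z : C) :
  z != 0 -> ~~ (0 < z) -> exists2 n, (0 < n)%N & 'Re (z ^+ n) <= 0.
Proof.
move=> z0 zN; pose w j := z ^+ (2 ^ j).
have wS j : w j.+1 = w j ^+ 2 by rewrite /w expnSr exprM.
have w0 j : 0 < `|w j| by rewrite normr_gt0 expf_neq0.
pose d j : C := `|w j| - 'Re (w j).
have d0 : 0 < d 0%N.
  rewrite subr_gt0 lt_neqAle (leif_Re_Creal _).1 andbT (leif_Re_Creal _).2 /w expr1.
  by apply: contra zN => z_ge0; rewrite lt0r z0.
have dS j : d j.+1 = 2 * d j * (`|w j| + 'Re (w j)).
  rewrite /d wS normrX expr2 ReM -!expr2.
  rewrite -mulrA -subr_sqr normC2_Re_Im; ring.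
pose x : C := d 0%N / `|w 0%N|; have x0 : 0 < x by rewrite divr_gt0.
pose n := Num.bound x^-1.
have n_big : 1 < x * 2 ^+ n.
  rewrite -ltr_pdivrMl // mulr1.
  have /archi_boundP/lt_trans-> // : 0 <= x^-1 by rewrite invr_ge0 ltW.
  by rewrite -natrX ltr_nat ltn_expl.
have [/forallP wP|] := boolP [forall j : 'I_n.+1, 0 < 'Re (w j)]; last first.
  case/forallPn=> j; rewrite -real_leNgt ?Creal_Re // => wj.
  by exists (2 ^ j)%N; rewrite ?expn_gt0.
have dn j : (j <= n)%N -> x * 2 ^+ j * `|w j| <= d j.
  elim: j => [|j IH] jn; first by rewrite mulr1 mulfVK ?gt_eqF.
  have {}IH := IH (ltnW jn); have Rj : 0 < 'Re (w j) := wP (Ordinal (leqW jn)).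
  have -> : x * 2 ^+ j.+1 * `|w j.+1| = 2 * (x * 2 ^+ j * `|w j|) * `|w j|.
    by rewrite wS normrX exprS; ring.
  rewrite dS; apply: ler_pM; rewrite ?mulr_ge0 ?exprn_ge0 ?ler_wpM2l ?invr_ge0 ?(ltW d0) //.
  by rewrite lerDl ltW.
have := dn n (leqnn n); have Rn : 0 < 'Re (w n) := wP ord_max.
rewrite real_leNgt ?rpredM ?rpredB ?rpredX ?realV ?Creal_Re ?normr_real ?realn //=.
rewrite (@lt_trans _ _ `|w n|) //; first by rewrite ltrBlDr ltrDl.
by rewrite ltr_pMl.
Qed.

Lemma exists_nneg_poly_root (C : archiClosedFieldType) (z : C) :
  z != 0 -> ~~ (0 < z) ->
  exists p : {poly C}, [/\ forall i, 0 <= p`_i, 0 < p`_0 & root p z].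
Proof.
move=> z0 /(exists_power_Re_le0 z0)[n n0 Rn]; set w := z ^+ n in Rn.
exists ('X^(n * 2) - ('Re w *+ 2) *: 'X^n + (`|w| ^+ 2)%:P); split.
- move=> i; rewrite !coefE -mulNr -mulNrn.
  by rewrite !addr_ge0 ?mulr_ge0 ?mulrn_wge0 ?oppr_ge0 //; case: ifP => // _; rewrite exprn_ge0.
- rewrite !coefE !(eq_sym 0%N) muln_eq0 orbF eqn0Ngt n0 mulr0 subr0 add0r.
  by rewrite exprn_gt0 // normr_gt0 expf_neq0.
- have e : 'Re w *+ 2 = w + w^* by rewrite ReE -mulr_natr divfK ?pnatr_eq0.
  by rewrite /root !hornerE exprM -/w normCK e; apply/eqP; ring.
Qed.

Lemma horner_ge_coef0 (R : numDomainType) (p : {poly R}) x :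
  (forall i, 0 <= p`_i) -> 0 <= x -> p`_0 <= p.[x].
Proof.
elim/poly_ind: p => [|p c _] pn x0; first by rewrite coef0 horner0.
have {}pn i : 0 <= p`_i.
  by move/(_ i.+1): pn; rewrite coefD coefMX coefC addr0.
rewrite hornerMXaddC coefD coefMX coefC eqxx /= add0r lerDr mulr_ge0 //.
by rewrite horner_coef sumr_ge0 // => i _; rewrite mulr_ge0 ?exprn_ge0.
Qed.

Lemma exists_nneg_poly_roots (C : archiClosedFieldType) (s : seq C) :
  (forall z, z \in s -> z != 0 /\ ~~ (0 < z)) ->
  exists p : {poly C}, [/\ forall i, 0 <= p`_i, 0 < p`_0 & all (root p) s].
Proof.
elim: s => [|z s IH] sP.
  by exists 1; split=> // [i|]; rewrite coef1 ?ltr01.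
have [|p [pn p0 ps]] := IH; first by move=> u us; apply: sP; rewrite inE us orbT.
have [|z0 zN] := sP z; first exact: mem_head.
have [q [qn q0 qz]] := exists_nneg_poly_root z0 zN.
exists (q * p); split; first by move=> i; rewrite coefM sumr_ge0 // => j _; rewrite mulr_ge0.
  by rewrite coefM big_ord_recl big_ord0 addr0 mulr_gt0.
by rewrite /= rootM qz /=; apply/allP=> u us; rewrite rootM (allP ps) ?orbT.
Qed.

(* Multiplying by 1 + x + ... + x^(d-1) makes the d lowest coefficients positive. *)
Lemma exists_nneg_poly_roots_lbound (C : archiClosedFieldType) (s : seq C) d :
  (forall z, z \in s -> z != 0 /\ ~~ (0 < z)) ->
  exists (p : {poly C}) e, [/\ forall i, 0 <= p`_i, 0 < e,
    forall j, (j < d)%N -> e <= p`_j & all (root p) s].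
Proof.
case/exists_nneg_poly_roots=> p [pn p0 ps].
have term0 (k j : nat) : 0 <= p`_k * (\poly_(i < d) (1 : C))`_j.
  by rewrite mulr_ge0 // coef_poly; case: ifP.
exists (p * \poly_(i < d) 1), p`_0; split=> //.
- by move=> k; rewrite coefM sumr_ge0.
- move=> j jd; rewrite coefM big_ord_recl /= subn0 coef_poly jd mulr1 lerDl.
  by rewrite sumr_ge0.
- by apply/allP=> z zs; rewrite rootM (allP ps).
Qed.

(** * Conjugates and minimal polynomials over the rationals *)

Lemma conjugate_root (a b : algC) (q : {poly rat}) :
  conjugate a b -> root (map_poly ratr q) a -> root (map_poly ratr q) b.
Proof.
case: (minQpolyP a) => pE _ pP; rewrite /conjugate pE pP => rb /dvdpP[u ->].
by rewrite rmorphM rootM rb orbT.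
Qed.

Lemma minQpoly_neq0 (a : algC) : minQpoly a != 0.
Proof. by case: (minQpolyP a) => _ /monic_neq0. Qed.

Lemma root_minQpoly (a : algC) : root (map_poly ratr (minQpoly a)) a.
Proof. by case: (minQpolyP a) => _ _ ->. Qed.

Lemma size_minQpoly_gt1 (a : algC) : (1 < size (minQpoly a))%N.
Proof.
by rewrite -(size_map_poly (@ratr algC)); case: (minQpolyP a) => <- _ _; apply: size_minCpoly.
Qed.

(** Irreducibility of the minimal polynomial: a cofactor vanishing at [a] is divisible by
    [minQpoly a], which leaves [d] constant. *)
Lemma dvdp_minQpoly (a : algC) d :
  d %| minQpoly a -> (size d == 1)%N || root (map_poly ratr d) a.
Proof.
case/dvdpP=> u pE; have p0 := minQpoly_neq0 a; have [_ _ pP] := minQpolyP a.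
move: p0; rewrite {1}pE mulf_eq0 negb_or => /andP[u0 d0].
have := root_minQpoly a; rewrite {1}pE rmorphM rootM => /orP[ua|->]; last by rewrite orbT.
have /(dvdp_leq u0) : minQpoly a %| u by rewrite -pP.
rewrite pE size_mul // -subn1 leq_subLR add1n => le_ud.
apply/orP; left; rewrite eqn_leq lt0n size_poly_eq0 d0 andbT.
by rewrite -(leq_add2l (size u)) addn1.
Qed.

Lemma separable_minCpoly (a : algC) : separable_poly (minCpoly a).
Proof.
have [-> mon pP] := minQpolyP a; rewrite separable_map.
set p := minQpoly a in mon pP *; have p1 : (1 < size p)%N := size_minQpoly_gt1 a.
rewrite unlock; have /dvdp_minQpoly/orP[//|] := dvdp_gcdl p p^`().
rewrite pP => /dvdp_trans/(_ (dvdp_gcdr _ _))/dvdp_leq.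
have p'0 : p^`() != 0.
  apply/eqP=> /polyP/(_ (size p).-2); rewrite coef0 coef_deriv prednK -?subn1 ?subn_gt0 //.
  rewrite subn1 -/(lead_coef p) (monicP mon) => /eqP; rewrite pnatr_eq0 /=.
  by rewrite -subn1 subn_eq0 leqNgt p1.
by move/(_ p'0); rewrite leqNgt lt_size_deriv // -size_poly_gt0 ltnW.
Qed.

Lemma conjugate0 (a : algC) : conjugate a 0 -> a = 0.
Proof.
have [pE _ _] := minQpolyP a; move=> p0.
have : root (minQpoly a) 0 by rewrite -(fmorph_root (@ratr algC)) rmorph0 -pE.
rewrite root_factor_theorem subr0 => /dvdp_minQpoly.
by rewrite size_polyX /= map_polyX rootX => /eqP.
Qed.

(** * Powers of a Perron number as natural combinations *)

Lemma perron_power_nat_combination (g : algC) :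
  perron_number g -> (forall b, conjugate g b -> 0 < b -> b = g) ->
  exists N (w : {poly nat}),
    (size w <= N)%N /\ g ^+ N = (map_poly (fun n => n%:R) w).[g].
Proof.
case=> /floorpP[f fE] g1 g_dom g_pos; have g0 : 0 < g := lt_trans ltr01 g1.
have [rs rsE] := closed_field_poly_normal (minCpoly g).
move: rsE; rewrite (monicP (minCpoly_monic g)) scale1r => rsE.
have rs_uniq : uniq rs by rewrite -separable_prod_XsubC -rsE separable_minCpoly.
have in_rs z : (z \in rs) = root (minCpoly g) z by rewrite rsE root_prod_XsubC.
have g_rs : g \in rs by rewrite in_rs root_minCpoly.
have mem_rem z : z \in rem g rs -> conjugate g z /\ z != g.
  by rewrite mem_rem_uniq // inE => /andP[zg]; rewrite in_rs.
have f_monic : f \is monic.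
  apply/monicP/(@intr_inj algC).
  rewrite -lead_coef_map_inj ?rmorph0 //; last exact: intr_inj.
  by rewrite -fE; apply/monicP/minCpoly_monic.
pose d := size rs.
have size_f : size f = d.+1.
  by rewrite -(size_map_inj_poly (@intr_inj algC)) // -fE rsE size_prod_XsubC.
have [|Q [e [Qn e0 Qe Qroots]]] := @exists_nneg_poly_roots_lbound _ (rem g rs) d.
  move=> z /mem_rem[gz zg]; split; last by apply: contra zg => /(g_pos _ gz)->.
  by apply/eqP=> z0; move: gz g0; rewrite z0 => /conjugate0->; rewrite ltxx.
have d0 : (0 < d)%N by rewrite /d; case: (rs) g_rs.
pose c := Q.[g].
have c0 : 0 < c.
  by apply: lt_le_trans (horner_ge_coef0 Qn (ltW g0)); apply: lt_le_trans (Qe 0%N d0).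
have [C C0 C_bound] := coef_bound_of_values rs_uniq.
pose Phi (z : algC) : algC := \sum_(i < size Q) `|z| ^+ i.
have Phi0 z : 0 <= Phi z by apply: sumr_ge0 => i _; rewrite exprn_ge0.
have K0 : 0 <= \sum_(z <- rs) Phi z by apply: sumr_ge0.
have C1 : 0 < C + 1 by rewrite ltr_wpDl.
(* With this constant, the interpolation bound [C] yields a coefficient error of at most e g^N / c,
   a lower bound for [q i] when i < d. *)
have delta0 : 0 < e / c / (C + 1) by rewrite !divr_gt0.
have [|N0 N0P] := @sum_geometric_dominates _ (rem g rs) _ _ _ g1 _ K0 delta0.
  by move=> z /mem_rem[gz zg]; apply: g_dom.
pose N := maxn N0 (maxn d (size Q)).
have {N0P} N_bound := N0P N (leq_maxl _ _).
have gN : 0 < g ^+ N by rewrite exprn_gt0.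
pose q i : algC := g ^+ N / c * Q`_i.
have q0 i : 0 <= q i by apply: mulr_ge0 => //; rewrite divr_ge0 ?ltW.
(* [H] rounds down the coefficients of degree at least d. As [L] is the remainder of 'X^N - H modulo
   [f], the sum H + L takes the value z^N at every root z of [f]. *)
pose H : {poly int} := \poly_(i < size Q) if (d <= i)%N then Num.floor (q i) else 0.
pose L := Pdiv.Ring.rmodp ('X^N - H) f.
have LE z : z \in rs -> (map_poly intr L).[z] = z ^+ N - (map_poly intr H).[z] :> algC.
  rewrite in_rs fE => /rootP fz.
  have := Pdiv.RingMonic.rdivp_eq f_monic ('X^N - H); rewrite -/L.
  move/(congr1 (fun u => (map_poly intr u).[z] : algC)).
  rewrite rmorphB rmorphD rmorphM /= map_polyXn hornerD hornerN hornerXn hornerD hornerM.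
  by rewrite fz mulr0 add0r.
have size_L : (size L <= d)%N.
  by rewrite -ltnS -size_f Pdiv.Ring.ltn_rmodpN0 ?monic_neq0.
pose T : {poly algC} := \poly_(i < d) q i.
pose Fr : {poly algC} := \poly_(i < size Q) if (d <= i)%N then q i - (Num.floor (q i))%:~R else 0.
have QE : (g ^+ N / c) *: Q = T + map_poly intr H + Fr.
  apply/polyP=> i; rewrite !coefD coefZ coef_map !coef_poly -/(q i).
  have [iQ|iQ] := ltnP i (size Q).
    by rewrite ltnNge; case: leqP => _; rewrite ?addr0 // add0r addrC subrK.
  by rewrite !addr0 /q nth_default // mulr0 if_same.
have FrE (z : algC) : `|Fr.[z]| <= Phi z.
  rewrite horner_poly (le_trans (ler_norm_sum _ _ _)) // ler_sum // => i _.
  rewrite normrM normrX ler_piMl ?exprn_ge0 //.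
  case: ifP => _; last by rewrite normr0 ler01.
  have /real_floor_itv/andP[fl fu] : q i \is Num.real by rewrite ger0_real.
  by rewrite ger0_norm ?subr_ge0 // lerBlDl (le_trans (ltW fu)) // intrD.
(* The value of L - T at z is z^N - (g^N / c) Q(z) + Fr(z). The first two terms cancel at g, where
   Q(g) = c; at the other roots Q vanishes. *)
have L_vals : \sum_(z <- rs) `|(map_poly intr L - T).[z]| <= e / c / (C + 1) * g ^+ N.
  apply: le_trans N_bound; rewrite !(big_rem g g_rs) /=.
  have valE z : z \in rs ->
      (map_poly intr L - T).[z] = z ^+ N - g ^+ N / c * Q.[z] + Fr.[z].
    move=> zrs; rewrite hornerD hornerN LE // -hornerZ QE !hornerD; ring.
  rewrite valE // -/c divfK ?gt_eqF // subrr add0r addrCA lerD //.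
  rewrite -big_split /= !big_seq ler_sum // => z zr.
  have zrs : z \in rs by rewrite in_rs; case: (mem_rem z zr).
  rewrite valE // (rootP (allP Qroots z zr)) mulr0 subr0.
  by rewrite (le_trans (ler_normD _ _)) // normrX lerD.
pose W : {poly int} := H + L.
have W_ge0 i : 0 <= W`_i.
  rewrite coefD coef_poly; have [di|id] := leqP d i.
    rewrite (nth_default _ (leq_trans size_L di)) addr0.
    by case: ifP => // _; rewrite real_floor_ge0 // ger0_real.
  rewrite if_same add0r -(@ler0z algC).
  have size_LT : (size (map_poly intr L - T)%R <= d)%N.
    rewrite (leq_trans (size_polyD _ _)) // geq_max size_polyN size_poly andbT.
    by rewrite (size_map_inj_poly (@intr_inj algC)).
  have := C_bound _ size_LT i; rewrite coefB coef_map coef_poly id /=.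
  move/le_trans/(_ (ler_wpM2l C0 L_vals)) => LT.
  (* The error does not exceed [q i] itself, so the low coefficients of [L] are nonnegative. *)
  have : `|(L`_i)%:~R - q i| <= q i.
    apply: le_trans LT _; rewrite mulrA /q [leRHS]mulrC [leRHS]mulrA [leRHS]mulrAC ler_pM2r //.
    apply: (@le_trans _ _ (e / c)); last by rewrite ler_pM2r ?invr_gt0 ?Qe.
    rewrite mulrCA ler_piMr ?divr_ge0 ?(ltW e0) ?(ltW c0) // ler_pdivrMr // mul1r.
    by rewrite lerDl ler01.
  rewrite real_ler_distl; first by rewrite subrr => /andP[].
  by rewrite rpredB ?realz // ger0_real.
have WE : g ^+ N = (map_poly intr W).[g] by rewrite rmorphD hornerD LE // addrC subrK.
exists N, (\poly_(i < N) absz W`_i); split; first exact: size_poly.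
rewrite WE; congr (_.[g]); apply/polyP=> i.
rewrite coef_map (coef_map_id0 (f := fun n => n%:R)) // coef_poly.
have [iN|Ni] := ltnP i N; first by rewrite natr_absz ger0_norm.
rewrite [W`_i]nth_default // (leq_trans _ Ni) // (leq_trans (size_polyD _ _)) //.
rewrite geq_max (leq_trans (size_poly _ _)) ?(leq_trans size_L) //.
  by rewrite !leq_max leqnn orbT.
by rewrite !leq_max leqnn !orbT.
Qed.

(** * Simple polynomials and roots with a common power *)

(** For j < e, this collects the coefficients of [f] in degrees congruent to j modulo e. The bound
    [size f] is crude, but loses nothing when e > 0. *)
Definition residue_part (R : nzRingType) (f : {poly R}) (e j : nat) : {poly R} :=
  \poly_(i < size f) f`_(i * e + j).

Lemma sum_residue_part (R : nzRingType) (f : {poly R}) e :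
  (0 < e)%N -> f = \sum_(j < e) (residue_part f e j \Po 'X^e) * 'X^j.
Proof.
move=> e0; apply/polyP=> k; rewrite coef_sum.
rewrite (bigD1 (Ordinal (ltn_pmod k e0))) //= [X in _ + X]big1 => [|j jk].
  rewrite addr0 coefMXn ltnNge leq_mod /= coef_comp_poly_Xn //.
  have -> : (k - k %% e = k %/ e * e)%N by rewrite {1}(divn_eq k e) addnK.
  rewrite dvdn_mull // mulnK // coef_poly -divn_eq.
  by case: ltnP => // le_k; rewrite nth_default // (leq_trans le_k) ?leq_div.
rewrite coefMXn; case: ltnP => // le_jk; rewrite coef_comp_poly_Xn //.
case: ifP => // e_jk; case/eqP: jk; apply: val_inj => /=.
by rewrite -(subnK le_jk) -modnDml (eqP e_jk) add0n modn_small.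
Qed.

Lemma size_residue_part (R : nzRingType) (f : {poly R}) e j :
  (0 < e)%N -> residue_part f e j != 0 ->
  (size (residue_part f e j \Po 'X^e) + j <= size f)%N.
Proof.
move=> e0; set r := residue_part f e j => r0.
have : f`_((size r).-1 * e + j) != 0.
  rewrite -lead_coef_eq0 /lead_coef coef_poly in r0.
  by case: ifP r0; rewrite ?eqxx.
move=> nz; have : ((size r).-1 * e + j < size f)%N.
  by rewrite ltnNge; apply: contra nz => /(nth_default _)->.
apply: leq_trans; rewrite -addSn leq_add2r.
by rewrite (leq_trans (size_comp_poly_leq _ _)) // size_polyXn.
Qed.

(* With K = Q(g ^ h), the minimal polynomial of g over K divides x ^ h - g ^ h, so
   its constant term is real of modulus g ^ e, where e is its degree.
   Hence g ^ e lies in K, which makes f a polynomial in x ^ e. *)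
Lemma simple_poly_root_eq (f : {poly rat}) (g y : algC) h :
  simple_poly f -> (forall q : {poly rat}, root (map_poly ratr q) g = (f %| q)) ->
  root (map_poly ratr f) y -> 0 < g -> (0 < h)%N -> y ^+ h = g ^+ h -> y = g.
Proof.
move=> [f1 f_simple] fP fy g0 h0 yg.
have [Qs [QsC [[|u []] // [uE] _]]] := num_field_exists [:: g].
pose K := <<1; u ^+ h>>%AS.
have [P [e [sP e0 P_monic PK P_dvd]]] : exists (P : {poly Qs}) e, [/\ size P = e.+1, (0 < e)%N,
    P \is monic, P \is a polyOver K
  & forall p, p \is a polyOver K -> root p u -> P %| p].
  exists (minPoly K u), (adjoin_degree K u).
  by split; [exact: size_minPoly| |exact: monic_minPoly|exact: minPolyOver|exact: minPoly_dvdp].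
have QsC_rat : QsC \o in_alg Qs =1 ratr.
  by apply: fmorph_eq_rat.
have map_ratr (q : {poly rat}) :
    map_poly ratr q = map_poly QsC (map_poly (in_alg Qs) q).
  by rewrite -map_poly_comp; apply: eq_map_poly => a; rewrite QsC_rat.
have rootE (q : {poly rat}) : root (map_poly (in_alg Qs) q) u = (f %| q).
  by rewrite -fP map_ratr -uE fmorph_root.
have K_rat x : x \in K -> exists q : {poly rat}, QsC x = (map_poly ratr q).[g ^+ h].
  case/Fadjoin_polyP=> _ /polyOver1P[q ->] ->; exists q.
  by rewrite map_ratr -uE -rmorphXn horner_map.
have uhK : u ^+ h \in K by exact: memv_adjoin.
have PC_monic : map_poly QsC P \is monic by rewrite monic_map.
have [s] := closed_field_poly_normal (map_poly QsC P).
rewrite (monicP PC_monic) scale1r => sE.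
have ss : size s = e by apply: succn_inj; rewrite -sP -(size_map_poly QsC) sE size_prod_XsubC.
have s_norm z : z \in s -> `|z| = g.
  rewrite -root_prod_XsubC -sE => zP.
  have : P %| 'X^h - (u ^+ h)%:P.
    apply: P_dvd; first by rewrite rpredB ?polyOverXn ?polyOverC.
    by rewrite /root !hornerE subrr.
  rewrite -(dvdp_map QsC).
  have -> : map_poly QsC ('X^h - (u ^+ h)%:P) = 'X^h - (g ^+ h)%:P.
    by rewrite rmorphB /= map_polyXn map_polyC /= rmorphXn /= uE.
  case/dvdpP=> v vE; have : root ('X^h - (g ^+ h)%:P) z by rewrite vE rootM zP orbT.
  rewrite /root !hornerE subr_eq0 => /eqP zh.
  apply: (pexpIrn h0); rewrite ?nnegrE ?(ltW g0) //.
  by rewrite -normrX zh normrX gtr0_norm.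
have P0_norm : `|QsC P`_0| = g ^+ e.
  rewrite -coef_map sE -horner_coef0 horner_prod normr_prod -ss.
  rewrite (eq_big_seq (fun _ => g)) => [|z zs].
    by rewrite big_const_seq count_predT iter_mulr_1.
  by rewrite !hornerE normrN s_norm.
(* Elements of [K] map to rational polynomials in the real number g^h, hence are real; so the
   constant term of [P] is g^e or -g^e. *)
have P0K : P`_0 \in K by apply/polyOverP.
have P0_real : QsC P`_0 \is Num.real.
  have [q ->] := K_rat _ P0K.
  rewrite horner_coef rpred_sum // => i _; rewrite coef_map rpredM //=.
    by rewrite Creal_Crat // rpred_rat.
  by rewrite !rpredX // ger0_real // ltW.
have ueK : u ^+ e \in K.
  move: P0_real; rewrite realE => /orP[P0_ge|P0_le].
    rewrite (_ : u ^+ e = P`_0) //; apply: (fmorph_inj QsC).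
    by rewrite rmorphXn /= uE -P0_norm ger0_norm.
  rewrite (_ : u ^+ e = - P`_0) ?rpredN //; apply: (fmorph_inj QsC).
  by rewrite rmorphXn rmorphN /= uE -P0_norm ler0_norm.
(* Writing g^e = q(g^h), [f] divides X^e - q(X^h), whence y^e = q(y^h) = q(g^h). *)
have y_e : y ^+ e = g ^+ e.
  have [q] := K_rat _ ueK; rewrite rmorphXn /= uE => qE.
  pose toC : {rmorphism {poly rat} -> {poly algC}} := map_poly (@ratr algC).
  have toCE z : (toC ('X^e - (q \Po 'X^h))).[z] = z ^+ e - (map_poly ratr q).[z ^+ h].
    by rewrite (rmorphB toC) /= map_comp_poly !map_polyXn !hornerE horner_comp hornerXn.
  have : f %| 'X^e - (q \Po 'X^h) by rewrite -fP /root toCE qE subrr.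
  case/dvdpP=> v vE.
  have : root (toC ('X^e - (q \Po 'X^h))) y by rewrite vE rmorphM rootM fy orbT.
  by rewrite /root toCE yg -qE subr_eq0 => /eqP.
pose r j := residue_part f e j.
have r_root j : (j < e)%N -> f %| r j \Po 'X^e.
  (* [S] has coefficients in [K], degree below e = deg P, and S(u) = f(u) = 0. Hence S = 0, and each
     r_j(X^e) vanishes at u. *)
  pose S := \poly_(j < e) (map_poly (in_alg Qs) (r j)).[u ^+ e].
  have SK : S \is a polyOver K.
    apply/polyOver_poly=> i _; apply: rpred_horner ueK.
    by apply: (polyOverSv (sub1v K)); apply/polyOver1P; exists (r i).
  have S0 : S = 0.
    apply/eqP; have : P %| S.
      apply: P_dvd SK _; have := dvdpp f; rewrite -rootE /root.
      rewrite {1}(sum_residue_part f e0) rmorph_sum horner_sum horner_poly => /eqP {2}<-.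
      apply/eqP/eq_bigr=> i _; rewrite rmorphM /= map_comp_poly !map_polyXn.
      by rewrite hornerM horner_comp !hornerXn.
    apply: contraTT => S0; apply/negP=> /(dvdp_leq S0); rewrite sP ltnNge.
    by rewrite size_poly.
  move=> je; rewrite -rootE map_comp_poly map_polyXn /root horner_comp hornerXn.
  by have /polyP/(_ j) := S0; rewrite coef_poly je coef0 => ->.
(* A nonzero r_j(X^e) would be a multiple of [f] of degree at most deg f - j. *)
have r0 j : (0 < j < e)%N -> r j = 0.
  case/andP=> j0 je; apply/eqP; apply: contraT => rj.
  have rj' : r j \Po 'X^e != 0.
    apply: contra rj => /eqP/polyP rX; apply/eqP/polyP=> i.
    by have := rX (i * e)%N; rewrite coef_comp_poly_Xn // dvdn_mull // mulnK // !coef0.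
  have := size_residue_part e0 rj; have := dvdp_leq rj' (r_root j je).
  move=> le1 /(leq_trans (leq_add le1 (leqnn j))).
  by rewrite -[leqRHS]addn0 leq_add2l leqn0 gtn_eqF.
have f_e i : ~~ (e %| i)%N -> f`_i = 0.
  move=> ei; have [lt_i|/(nth_default _)//] := ltnP i (size f).
  have /r0/polyP/(_ (i %/ e)%N) : (0 < i %% e < e)%N by rewrite lt0n ei ltn_pmod.
  by rewrite coef0 coef_poly -divn_eq (leq_ltn_trans (leq_div _ _)).
have [e1 _] := f_simple e _ e0 (decimate_polyK e0 f_e).
by move: y_e; rewrite e1 !expr1.
Qed.

(** * Natural polynomials and the splitting of 1 *)

Definition nat_eval (x : algC) (p : {poly nat}) : algC :=
  (map_poly (fun n => n%:R) p).[x].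

Lemma nat_evalE x p : nat_eval x p = \sum_(i < size p) (p`_i)%R%:R * x ^+ i.
Proof. by rewrite /nat_eval /map_poly horner_poly. Qed.

Lemma nat_evalD x p q : nat_eval x (p + q) = nat_eval x p + nat_eval x q.
Proof. by rewrite /nat_eval rmorphD hornerD. Qed.

Lemma nat_evalM x p q : nat_eval x (p * q) = nat_eval x p * nat_eval x q.
Proof. by rewrite /nat_eval rmorphM hornerM. Qed.

Lemma nat_eval0 x : nat_eval x 0 = 0.
Proof. by rewrite /nat_eval rmorph0 horner0. Qed.

Lemma nat_evalC x n : nat_eval x n%:P = n%:R.
Proof. by rewrite /nat_eval map_polyC hornerC. Qed.

Lemma nat_evalXn x n : nat_eval x 'X^n = x ^+ n.
Proof. by rewrite /nat_eval map_polyXn hornerXn. Qed.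

Lemma nat_eval_ge_term x (p : {poly nat}) i : 0 <= x -> (p`_i)%R%:R * x ^+ i <= nat_eval x p.
Proof.
move=> x0; rewrite nat_evalE; have [ip|pi] := ltnP i (size p).
  rewrite (bigD1 (Ordinal ip)) //= lerDl sumr_ge0 // => j _.
  by rewrite mulr_ge0 ?exprn_ge0.
by rewrite nth_default // mul0r sumr_ge0 // => j _; rewrite mulr_ge0 ?exprn_ge0.
Qed.

Lemma nat_eval_gt0 x p : 0 < x -> p != 0 -> 0 < nat_eval x p.
Proof.
move=> x0 p0; apply: lt_le_trans (nat_eval_ge_term p (size p).-1 (ltW x0)).
by rewrite mulr_gt0 ?exprn_gt0 // ltr0n lt0n -/(lead_coef p) lead_coef_eq0.
Qed.

Lemma nat_eval_ltr x y (p : {poly nat}) i :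
  0 <= x < y -> (0 < i)%N -> p`_i != 0%N -> nat_eval x p < nat_eval y p.
Proof.
case/andP=> x0 xy i0 pi; rewrite !nat_evalE.
have ip : (i < size p)%N by rewrite ltnNge; apply: contra pi => /(nth_default _)->.
rewrite (bigD1 (Ordinal ip)) //= [ltRHS](bigD1 (Ordinal ip)) //=.
apply: ltr_leD.
  by rewrite ltr_pM2l ?ltr0n ?lt0n // ltrXn2r // -lt0n.
apply: ler_sum => j _; apply: ler_wpM2l => //.
by apply: lerXn2r; rewrite ?nnegrE // ?ltW // (le_lt_trans x0).
Qed.

Lemma norm_nat_eval_le x p : `|nat_eval x p| <= nat_eval `|x| p.
Proof.
rewrite !nat_evalE (le_trans (ler_norm_sum _ _ _)) // ler_sum // => i _.
by rewrite normrM normrX normr_nat.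
Qed.

Lemma nat_eval_coef x (p : {poly nat}) :
  p`_0 = 0%N -> nat_eval x p != 0 -> exists2 i, (0 < i)%N & p`_i != 0%N.
Proof.
move=> p0 px; have : p != 0 by apply: contraNneq px => ->; rewrite nat_eval0.
rewrite -lead_coef_eq0 => lp; exists (size p).-1 => //.
by rewrite lt0n; apply: contra lp => /eqP sp; rewrite /lead_coef sp p0.
Qed.

Lemma nat_eval_monoidM (alpha x y : algC) :
  nat_eval_monoid alpha x -> nat_eval_monoid alpha y ->
  nat_eval_monoid alpha (x * y).
Proof. by move=> [p ->] [q ->]; exists (p * q); rewrite -[LHS]nat_evalM. Qed.

Lemma nat_eval_monoid_ge0 (alpha x : algC) :
  0 < alpha -> nat_eval_monoid alpha x -> 0 <= x.
Proof.
move=> alpha_gt0 [p ->]; rewrite -/(nat_eval alpha p); have [->|p0] := eqVneq p 0.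
  by rewrite nat_eval0.
exact/ltW/nat_eval_gt0.
Qed.

Lemma invertible_nat_eval_monoid (alpha x : algC) :
  0 < alpha -> invertible_in (nat_eval_monoid alpha) x <-> x = 0.
Proof.
move=> alpha_gt0; split=> [[Mx [y My xy]]|->]; last first.
  by split; [exact: nat_eval_monoid0|exists 0; rewrite ?addr0 //; exact: nat_eval_monoid0].
apply/eqP; rewrite eq_le (nat_eval_monoid_ge0 alpha_gt0 Mx) andbT -xy lerDl.
exact: nat_eval_monoid_ge0 My.
Qed.

(* Every nonzero element is a multiple of 1, so antimatter just says that 1 splits
   into nonzero elements; the classical step turns "1 is not an atom" into a
   splitting. *)
Lemma antimatter_nat_eval_monoid (alpha : algC) :
  0 < alpha ->
  antimatter (nat_eval_monoid alpha) <->
  exists w : {poly nat}, [/\ w`_0 = 0%N, nat_eval alpha w = 1 & alpha < 1].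
Proof.
move=> alpha_gt0; have invE x := @invertible_nat_eval_monoid alpha x alpha_gt0.
split=> [anti|[w [w0 w1 a1]] a [[p aE] aI atom]].
  apply: NNPP => no_w; apply: (anti 1); split.
  - by exists 1; rewrite rmorph1 hornerE.
  - by move/invE/eqP; rewrite oner_eq0.
  move=> b c [p bE] [q cE]; rewrite -/(nat_eval alpha p) in bE; rewrite -/(nat_eval alpha q) in cE.
  have [p0|p0] := eqVneq p 0.
    by left; apply/invE; rewrite bE p0 nat_eval0.
  have [q0|q0] := eqVneq q 0.
    by right; apply/invE; rewrite cE q0 nat_eval0.
  have b0 : 0 < b by rewrite bE nat_eval_gt0.
  have c0 : 0 < c by rewrite cE nat_eval_gt0.
  move=> bc; case: no_w; exists (p + q).
  (* Each monomial present in [r] is at most r(alpha) < 1. Exponent 0 is therefore excluded, and the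
     leading exponent of [p] gives alpha < 1. *)
  have lt1 r i : nat_eval alpha r < 1 -> r`_i != 0%N -> alpha ^+ i < 1.
    move=> r1 ri; apply: le_lt_trans r1; apply: le_trans (nat_eval_ge_term _ i (ltW alpha_gt0)).
    by rewrite ler_peMl ?exprn_ge0 ?(ltW alpha_gt0) // ler1n lt0n.
  have p_lt1 : nat_eval alpha p < 1 by rewrite -bE bc ltrDl.
  have q_lt1 : nat_eval alpha q < 1 by rewrite -cE bc ltrDr.
  split.
  - rewrite coefD; apply/eqP; rewrite addn_eq0; apply/andP; split.
      by apply: contraT => /(lt1 _ _ p_lt1); rewrite ltxx.
    by apply: contraT => /(lt1 _ _ q_lt1); rewrite ltxx.
  - by rewrite nat_evalD -bE -cE bc.
  - have := lt1 p (size p).-1 p_lt1; rewrite -/(lead_coef p) lead_coef_eq0 => /(_ p0).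
    case: (_.-1) => [|n]; first by rewrite ltxx.
    by rewrite expr_lt1 // ltW.
rewrite -/(nat_eval alpha p) in aE.
have [|i i0 wi] := nat_eval_coef w0 (x := alpha); first by rewrite w1 oner_eq0.
(* Removing one copy of X^i from [w] splits a into a alpha^i + a v(alpha); v(alpha) = 1 - alpha^i is
   positive because alpha < 1. *)
pose v : {poly nat} := \poly_(k < size w) ((w`_k)%R - (k == i))%N.
have wE : w = 'X^i + v.
  apply/polyP=> k; rewrite coefD coefXn coef_poly.
  have [kw|wk] := ltnP k (size w).
    by case: eqP => [->|_]; rewrite ?subn0 //= [RHS]subnKC // lt0n.
  rewrite nth_default //; case: eqP => // ki; move: wi.
  by rewrite nth_default ?eqxx // -ki.
have a0 : 0 < a.
  rewrite aE nat_eval_gt0 //; apply: contra_notN aI => /eqP p0.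
  by apply/invE; rewrite aE p0 nat_eval0.
have v0 : 0 < nat_eval alpha v.
  have := w1; rewrite wE nat_evalD nat_evalXn => /(canRL (addKr _)) ->.
  by rewrite addrC subr_gt0 exprn_ilt1 ?ltW // -lt0n.
have [|||/invE/eqP|/invE/eqP] :=
    atom (a * alpha ^+ i) (a * nat_eval alpha v).
- by apply: nat_eval_monoidM; [exists p|exists 'X^i; rewrite -nat_evalXn].
- by apply: nat_eval_monoidM; [exists p|exists v].
- by rewrite -mulrDr -nat_evalXn -nat_evalD -wE w1 mulr1.
- by rewrite gt_eqF // mulr_gt0 ?exprn_gt0.
- by rewrite gt_eqF // mulr_gt0.
Qed.

(** * Annihilators of the inverse and of its powers *)

Lemma horner_reciprocal_poly (p : {poly rat}) (z : algC) :
  z != 0 -> (map_poly ratr (reciprocal_poly p)).[z] =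
            z ^+ (size p).-1 * (map_poly ratr p).[z^-1].
Proof.
move=> z0; rewrite rmorph_sum horner_sum horner_coef size_map_poly mulr_sumr.
apply: eq_bigr => i _; rewrite /= map_polyZ map_polyXn hornerZ hornerXn coef_map.
rewrite mulrCA exprVn exprB ?unitfE //.
by case: (size p) i => [[]|n] i //=; rewrite -ltnS.
Qed.

Lemma size_reciprocal_poly (p : {poly rat}) : (size (reciprocal_poly p) <= size p)%N.
Proof.
apply: (leq_trans (size_sum _ _ _)); apply/bigmax_leqP=> i _.
rewrite (leq_trans (size_scale_leq _ _)) // size_polyXn.
by rewrite (leq_ltn_trans (leq_subr _ _)) // prednK // (leq_ltn_trans _ (ltn_ord i)).
Qed.

Lemma root_reciprocal_minQpoly (a z : algC) :
  z != 0 ->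
  root (map_poly ratr (reciprocal_poly (minQpoly a))) z = root (minCpoly a) z^-1.
Proof.
move=> z0; have [-> _ _] := minQpolyP a; rewrite /root horner_reciprocal_poly //.
by rewrite mulf_eq0 expf_eq0 (negPf z0) andbF.
Qed.

(** The minimal polynomial of 1 / a divides the reciprocal polynomial. Comparing degrees for both a
    and 1 / a shows that the two are associated. *)
Lemma reciprocal_minQpolyP (a : algC) (q : {poly rat}) :
  a != 0 -> root (map_poly ratr q) a^-1 = (reciprocal_poly (minQpoly a) %| q).
Proof.
have dvd b : b != 0 -> minQpoly b^-1 %| reciprocal_poly (minQpoly b).
  move=> b0; have [_ _ <-] := minQpolyP b^-1.
  by rewrite root_reciprocal_minQpoly ?invr_eq0 // invrK root_minCpoly.
have size_le b : b != 0 -> (size (minQpoly b^-1) <= size (reciprocal_poly (minQpoly b)))%N.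
  by move=> b0; rewrite dvdp_leq ?dvd // -size_poly_gt0 ltnW // size_reciprocal_minQpoly.
move=> a0; have [_ _ ->] := minQpolyP a^-1.
suff /eqp_dvdl : minQpoly a^-1 %= reciprocal_poly (minQpoly a) by apply.
rewrite -dvdp_size_eqp ?dvd // eqn_leq size_le // (leq_trans (size_reciprocal_poly _)) //.
have := size_le a^-1; rewrite invrK invr_eq0 => /(_ a0)/leq_trans-> //.
exact: size_reciprocal_poly.
Qed.

(* If f = g(x ^ k) generates the annihilator of b, then g generates that of b ^ k. *)
Lemma dvdp_of_comp_polyXn (f g : {poly rat}) (b : algC) k :
  (0 < k)%N -> (1 < size f)%N -> f = g \Po 'X^k ->
  (forall q : {poly rat}, root (map_poly ratr q) b = (f %| q)) ->
  forall q : {poly rat}, root (map_poly ratr q) (b ^+ k) = (g %| q).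
Proof.
move=> k0 f1 fE fP.
have rootXn (q : {poly rat}) : root (map_poly ratr q) (b ^+ k) = (f %| q \Po 'X^k).
  by rewrite -fP map_comp_poly map_polyXn /root horner_comp hornerXn.
move=> q; rewrite rootXn; apply/idP/idP=> [|/dvdpP[u ->]]; last first.
  by rewrite rmorphM /= -fE dvdp_mull.
have sE (h : {poly rat}) : (size (h \Po 'X^k)).-1 = ((size h).-1 * k)%N.
  by rewrite size_comp_poly size_polyXn.
(* If [r] is the remainder of [q] modulo [g], then [f] divides r(X^k), whose degree is below deg f
   unless r = 0. *)
rewrite {1}(divp_eq q g) rmorphD rmorphM /= -fE dvdp_addr ?dvdp_mull // => f_dvd.
have g0 : g != 0.
  by apply: contraTneq f1 => g0; rewrite fE g0 comp_poly0 size_poly0.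
apply: contraT => r0; rewrite /dvdp in r0.
have rk0 : (q %% g) \Po 'X^k != 0.
  apply: contra r0 => /eqP/polyP rk; apply/eqP/polyP=> i.
  by have := rk (i * k)%N; rewrite coef_comp_poly_Xn // dvdn_mull // mulnK // !coef0.
have := dvdp_leq rk0 f_dvd; rewrite leqNgt => /negP[].
rewrite -size_poly_gt0 in rk0.
rewrite -(prednK (ltnW f1)) -(prednK rk0) ltnS fE !sE ltn_pmul2r //.
by rewrite -ltnS !prednK ?size_poly_gt0 // ltn_modp.
Qed.

(** * From splittings of 1 to Perron roots and back *)

Theorem corollary4p6 (alpha : algC) (alpha_gt0 : 0 < alpha) :
  antimatter (nat_eval_monoid alpha) <->
  (exists2 x : algC,
     perron_number x
     & root (map_poly ratr (simplified_poly (reciprocal_poly (minQpoly alpha)))) x)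
  /\ (forall beta : algC, conjugate alpha beta -> 0 < beta -> beta = alpha).
Proof.
have a0 : alpha != 0 by rewrite gt_eqF.
have r1 := size_reciprocal_minQpoly a0; have rP q := reciprocal_minQpolyP q a0.
have r_root z := @root_reciprocal_minQpoly alpha z.
have [g_simple [k k0 rE]] := simplified_polyP r1.
move: (reciprocal_poly _) (simplified_poly _) => r g in r1 rP r_root g_simple rE *.
have g_root (z : algC) : root (map_poly ratr g) (z ^+ k) = root (map_poly ratr r) z.
  by rewrite rE map_comp_poly map_polyXn /root horner_comp hornerXn.
have gP := dvdp_of_comp_polyXn k0 r1 rE rP.
pose b := alpha^-1; have b0 : 0 < b by rewrite invr_gt0.
pose gam := b ^+ k; have gam0 : 0 < gam by rewrite exprn_gt0.
rewrite antimatter_nat_eval_monoid //; split=> [[w [w0 w1 a1]]|[[x [xA x1 x_dom] gx] a_uniq]].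
  have [|i i0 wi] := nat_eval_coef w0 (x := alpha); first by rewrite w1 oner_eq0.
  have b1 : 1 < b by rewrite invf_gt1.
  have w_conj c : conjugate alpha c -> nat_eval c w = 1.
    pose w' : {poly rat} := map_poly (fun n => n%:R) w - 1.
    have w'E z : (map_poly ratr w').[z] = nat_eval z w - 1.
      rewrite rmorphB rmorph1 /= hornerD hornerN hornerC /nat_eval -map_poly_comp.
      by congr (_.[z] - 1); apply: eq_map_poly => n /=; rewrite rmorph_nat.
    move/(conjugate_root (q := w')); rewrite /root !w'E w1 subrr eqxx => /(_ isT).
    by rewrite subr_eq0 => /eqP.
  (* If |c| < alpha, then 1 = |w(c)| <= w(|c|) < w(alpha) = 1. *)
  have norm_ge c : conjugate alpha c -> alpha <= `|c|.
    move=> /w_conj c1; rewrite real_leNgt ?normr_real ?gtr0_real //; apply/negP=> lt_c.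
    have := @nat_eval_ltr `|c| alpha w i; rewrite lt_c normr_ge0 => /(_ isT i0 wi).
    rewrite w1; have := norm_nat_eval_le c w; rewrite c1 normr1.
    by move=> /le_lt_trans le /le; rewrite ltxx.
  have norm_eq c : conjugate alpha c -> `|c| = alpha -> c ^+ i = alpha ^+ i.
    move=> /w_conj c1 ca.
    have iw : (i < size w)%N by rewrite ltnNge; apply: contra wi => /(nth_default _)->.
    (* Equality in the triangle inequality forces equality term by term; the term of index i is the
       one needed. *)
    have := normC_sum_upper (P := xpredT) (F := fun j : 'I_(size w) => (w`_j)%R%:R * c ^+ j)
      (G := fun j : 'I_(size w) => (w`_j)%R%:R * alpha ^+ j).
    rewrite -!nat_evalE c1 w1 => /(_ _ erefl (Ordinal iw) isT) /= e.
    apply: (mulfI (x := (w`_i)%R%:R)); first by rewrite pnatr_eq0.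
    by apply: e => j _; rewrite normrM normrX ca normr_nat.
  split; last first.
    move=> c ac c0; have := norm_ge c ac; rewrite gtr0_norm // le_eqVlt => /orP[/eqP//|lt_c].
    have := @nat_eval_ltr alpha c w i; rewrite lt_c ltW // => /(_ isT i0 wi).
    by rewrite w1 w_conj // ltxx.
  exists gam; last by rewrite g_root r_root ?invr_eq0 // invrK root_minCpoly.
  split.
  - apply: rpredX; pose n := size w.
    (* Multiplying w(alpha) = 1 by b^n makes b a root of X^n - S, which is monic since w_0 = 0 keeps
       deg S below n. *)
    pose S : {poly algC} := \sum_(j < n) (w`_j)%R%:R *: 'X^(n - j).
    have size_S : (size S <= n)%N.
      apply: (leq_trans (size_sum _ _ _)); apply/bigmax_leqP=> j _.
      case: (posnP j) => [->|j0]; first by rewrite w0 scale0r size_poly0.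
      rewrite (leq_trans (size_scale_leq _ _)) // size_polyXn ltn_subrL j0 /=.
      by rewrite /n (leq_ltn_trans _ (ltn_ord j)).
    apply: (@root_monic_Aint ('X^n - S)).
    + rewrite /root hornerD hornerN hornerXn horner_sum subr_eq0.
      rewrite -[eqbLHS]mulr1 -[X in _ * X == _]w1 nat_evalE mulr_sumr; apply/eqP/eq_bigr=> j _.
      rewrite hornerZ hornerXn mulrCA exprB ?(ltnW (ltn_ord j)) ?unitfE ?invr_eq0 //.
      by rewrite /b -exprVn invrK.
    + by rewrite monicE lead_coefDl ?lead_coefXn // size_polyN size_polyXn ltnS.
    + apply/polyOverP=> m; rewrite coefB coefXn coef_sum rpredB ?rpred_nat //.
      by apply: rpred_sum => j _; rewrite coefZ coefXn rpredM ?rpred_nat.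
  - by rewrite exprn_egt1 // -lt0n.
  (* For y nonzero, 1 / z is a conjugate of alpha, so |z| <= b. Equality gives z^i = b^i, hence y^i
     = gam^i and y = gam by simplicity. *)
  - move=> y gy y_neq; pose z := k.-root y.
    have zk : z ^+ k = y by rewrite rootCK.
    have [->|y0] := eqVneq y 0; first by rewrite normr0.
    have z0 : z != 0 by apply: contraNneq y0 => z0; rewrite -zk z0 expr0n gtn_eqF.
    have y_root : root (map_poly ratr g) y.
      by apply: conjugate_root gy _; rewrite g_root rP.
    have az : conjugate alpha z^-1 by rewrite /conjugate -r_root // -g_root zk.
    have := norm_ge _ az; rewrite le_eqVlt => /orP[/eqP/esym az_eq|lt_az].
      case/eqP: y_neq; apply: (simple_poly_root_eq g_simple gP y_root gam0 i0).
      have := norm_eq _ az az_eq; rewrite exprVn => /(canRL invrK) zi.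
      by rewrite -zk /gam [LHS]exprAC [RHS]exprAC zi -exprVn.
    rewrite -zk normrX ltrXn2r ?normr_ge0 ?ltW // -?lt0n //.
    by rewrite -[`|z|]invrK ltf_pV2 ?posrE ?invr_gt0 ?normr_gt0 // -normfV.
(* The inverse of the positive k-th root of y is a positive conjugate of alpha. *)
have root_gt0 y : root (map_poly ratr g) y -> 0 < y -> y = gam.
  move=> gy y0; have z0 : 0 < k.-root y by rewrite rootC_gt0.
  have zk : (k.-root y) ^+ k = y by rewrite rootCK.
  rewrite -zk g_root r_root ?gt_eqF // in gy.
  by rewrite -zk -[k.-root y]invrK (a_uniq _ gy) ?invr_gt0.
have x_gam := root_gt0 x gx (lt_trans ltr01 x1).
have [|N [w [sw wE]]] := @perron_power_nat_combination x (And3 xA x1 x_dom).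
  move=> y xy y0; rewrite x_gam; apply: root_gt0 => //; exact: conjugate_root xy gx.
(* Dividing x^N = w(x) by x^N and using 1 / x = alpha^k gives this sum. All its exponents are
   positive because i < size w <= N. *)
exists (\sum_(i < size w) (w`_i)%:P * 'X^(k * (N - i))); split.
- rewrite coef_sum big1 // => i _; rewrite coefCM coefXn eq_sym muln_eq0 gtn_eqF //=.
  by rewrite subn_eq0 leqNgt (leq_trans (ltn_ord i)) // mulr0.
- have xN0 : x ^+ N != 0 by rewrite expf_neq0 // gt_eqF // (lt_trans ltr01).
  apply: (mulfI xN0); rewrite mulr1 {2}wE -/(nat_eval x w) (nat_evalE x w).
  rewrite (big_morph _ (nat_evalD alpha) (nat_eval0 alpha)) mulr_sumr.
  apply: eq_bigr => i _; rewrite nat_evalM nat_evalC nat_evalXn mulrCA; congr (_ * _).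
  have iN : (i <= N)%N := leq_trans (ltnW (ltn_ord i)) sw.
  rewrite x_gam -{1}(subnK iN) exprD exprM mulrAC -exprMn -/gam.
  by rewrite /gam -exprMn mulVf // !expr1n mul1r.
- by move: x1; rewrite x_gam expr_gt1 ?(ltW b0) // invf_gt1.
Qed.
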